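(* Let $E\in\mathbb N$ and let $0<\eta<\frac{2}{E}$. Let $A=\sum_{k,l=0}^{+\infty}A_{kl}\ket{k}\!\bra{l}$ be an operator on the single-mode Hilbert space $\mathcal H$, and let $\rho=\sum_{k,l=0}^{E}\rho_{kl}\ket{k}\!\bra{l}$ be a density operator with support bounded by $E$ in the Fock basis. Then $$\left|\mathrm{Tr}(A\rho)-\mathbb E_{\alpha\leftarrow Q_\rho}\big[f_A(\alpha,\eta)\big]\right|\le \eta K_A .$$
   Context: $\mathcal H$ is the single-mode (infinite-dimensional, separable) Hilbert space with Fock basis $\{\ket n\}_{n\in\mathbb N}$. For $\alpha\in\mathbb C$, $\ket\alpha$ denotes the coherent state. The Husimi function of a state $\rho$ is $Q_\rho(\alpha)=\frac{1}{\pi}\bra\alpha\rho\ket\alpha$, a probability density on $\mathbb C$; heterodyne detection of $\rho$ yields a sample $\alpha\in\mathbb C$ distributed according to $Q_\rho$, and $\mathbb E_{\alpha\leftarrow Q_\rho}[g(\alpha)]=\int_{\mathbb C} Q_\rho(\alpha)g(\alpha)\,d^2\alpha$. For $k,l\ge 0$ and $z\in\mathbb C$ define the polynomials $$\mathcal L_{k,l}(z)=e^{zz^*}\frac{(-1)^{k+l}}{\sqrt{k!}\sqrt{l!}}\frac{\partial^{k+l}}{\partial z^k\partial z^{*l}}e^{-zz^*}=\sum_{p=0}^{\min(k,l)}\frac{\sqrt{k!}\sqrt{l!}(-1)^p}{p!(k-p)!(l-p)!}z^{l-p}z^{*(k-p)}.$$ For an operator $A=\sum_{k,l}A_{kl}\ket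 k\!\bra l$, the fixed cutoff $E\in\mathbb N$, $z\in\mathbb C$ and $0<\eta<1$, define $$f_A(z,\eta)=\frac{1}{\eta}e^{(1-\frac1\eta)zz^*}\sum_{k,l=0}^{E}\frac{A_{kl}}{\sqrt{\eta^{k+l}}}\,\mathcal L_{k,l}\!\left(\frac{z}{\sqrt\eta}\right),\qquad K_A=\sum_{k,l=0}^{E}|A_{kl}|\sqrt{(k+1)(l+1)}.$$ *)

(* Defs.v *)
From HB Require Import structures.
From mathcomp Require Import all_boot all_order all_algebra.
From mathcomp Require Import all_classical all_reals all_analysis.
From mathcomp Require Import complex.
Set Implicit Arguments. Unset Strict Implicit. Unset Printing Implicit Defensive.
Import Order.TTheory GRing.Theory Num.Theory.
Local Open Scope complex_scope.
Local Open Scope ring_scope.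

Section QDefs.
Variable R : realType.
Local Notation C := R[i].

Definition cmodsq (z : C) : R := complex.Re z ^+ 2 + complex.Im z ^+ 2.

Definition cabs (z : C) : R := Num.sqrt (cmodsq z).

(* Fock coefficients of the coherent state: <n|alpha> = e^{-|alpha|^2/2} alpha^n / sqrt(n!) *)
Definition coh (alpha : C) (n : nat) : C :=
  (expR (- cmodsq alpha / 2))%:C * alpha ^+ n / (Num.sqrt (n`!)%:R)%:C.

Definition adjmx m n (M : 'M[C]_(m, n)) : 'M[C]_(n, m) := (map_mx (@conjc R) M)^T.

(* density operator on H supported on span{|0>,...,|E>}: its (E+1)x(E+1) block
   rho_{kl} = <k|rho|l> is Hermitian, positive semidefinite, with unit trace *)
Definition density_op (E : nat) (rho : 'M[C]_(E.+1)) : Prop :=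
  [/\ adjmx rho = rho,
      (forall v : 'cV[C]_(E.+1), 0 <= (adjmx v *m rho *m v) ord0 ord0)
    & \tr rho = 1].

(* Husimi function Q_rho(alpha) = (1/pi) <alpha|rho|alpha> *)
Definition husimi (E : nat) (rho : 'M[C]_(E.+1)) (alpha : C) : C :=
  (pi^-1)%:C * \sum_(k < E.+1) \sum_(l < E.+1)
                 conjc (coh alpha k) * rho k l * coh alpha l.

(* Lebesgue measure on C identified with R x R (d^2 alpha = dx dy) *)
Definition leb2 := ((@lebesgue_measure R) \x (@lebesgue_measure R))%E.

Definition cintegral (g : C -> C) : C :=
  (Rintegral leb2 setT (fun p : R * R => complex.Re (g (p.1 +i* p.2)%C)))%:C
  + 'i%C * (Rintegral leb2 setT (fun p : R * R => complex.Im (g (p.1 +i* p.2)%C)))%:C.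

Definition heterodyne_expect (E : nat) (rho : 'M[C]_(E.+1)) (g : C -> C) : C :=
  cintegral (fun alpha => husimi rho alpha * g alpha).

Definition Lpoly (k l : nat) (z : C) : C :=
  \sum_(p < (minn k l).+1)
    ((Num.sqrt (k`!)%:R * Num.sqrt (l`!)%:R * (-1) ^+ p
      / ((p`!)%:R * ((k - p)`!)%:R * ((l - p)`!)%:R))%:C
     * z ^+ (l - p) * (conjc z) ^+ (k - p)).

(* operator A given by its Fock matrix elements A_{kl} = <k|A|l> *)
Definition fA (E : nat) (A : nat -> nat -> C) (z : C) (eta : R) : C :=
  (eta^-1)%:C * (expR ((1 - eta^-1) * cmodsq z))%:C *
  \sum_(k < E.+1) \sum_(l < E.+1)
     A k l / (Num.sqrt (eta ^+ (k + l)))%:C * Lpoly k l (z / (Num.sqrt eta)%:C).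

Definition KA (E : nat) (A : nat -> nat -> C) : R :=
  \sum_(k < E.+1) \sum_(l < E.+1)
     cabs (A k l) * Num.sqrt ((k.+1 * l.+1)%:R).

Definition trace_A_rho (E : nat) (A : nat -> nat -> C) (rho : 'M[C]_(E.+1)) : C :=
  \sum_(k < E.+1) \sum_(l < E.+1) A k l * rho l k.

End QDefs.

(* Main.v *)
Require Import Defs.
From HB Require Import structures.
From mathcomp Require Import all_boot all_order all_algebra.
From mathcomp Require Import all_classical all_reals all_analysis.
From mathcomp Require Import complex.
From mathcomp Require Import measurable_realfun ring lra zify.
Import Order.TTheory GRing.Theory Num.Theory.
Import numFieldNormedType.Exports.
Local Open Scope classical_set_scope.
Local Open Scope complex_scope.
Local Open Scope ring_scope.

(** The integrand [Q_rho * f_A] is [e^{-|z|^2/eta}] times a polynomial in [z] and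
    [conj z], so the expectation reduces to the Gaussian moments of
    [z^a (conj z)^b], which vanish unless [a = b].  Summing the alternating
    series of Laguerre coefficients with Vandermonde-like cancellation gives
      [E[f_A] = \sum_(k,l) A_kl \sum_(j >= 0)
                  eta^j sqrt (C(k+j,k) C(l+j,l)) rho_(l+j,k+j)],
    whose [j = 0] part is [Tr (A rho)].  For [1 <= j <= E - k], the hypothesis
    [eta E < 2] makes [eta^j C(k+j,k)] nonincreasing in [j], hence at most
    [eta (k+1)]; and [\sum_j |rho_(l+j,k+j)| <= 1] because
    [2 |rho_ab| <= rho_aa + rho_bb] and [rho] has unit trace.

    The moments of [z^a (conj z)^b] are obtained without polar coordinates:
    integration by parts in one real variable yields, for every polynomial [P],
    [2 \int z P e^{-|z|^2/eta} = eta \int (d_x + i d_y) P e^{-|z|^2/eta}], and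
    [d_x + i d_y] kills [z] and maps [conj z] to [2]. *)

(** * Gaussian moments on the real line *)

Section GaussianMoments.
Variable R : realType.
Implicit Types (s x : R) (n : nat).
Notation mu := (@lebesgue_measure R).

(** The fundamental theorem gives [F n - F (- n)] on [[-n, n]], and dominated convergence with bound
    [|f|] lets [n] grow. This is integration by parts without boundary terms. *)
Lemma Rintegral_derive_eq0 (f F : R -> R) :
  continuous f -> mu.-integrable setT (EFin \o f) ->
  (forall x, is_derive x 1 F (f x)) ->
  F n%:R @[n --> \oo] --> (0 : R) -> F (- n%:R) @[n --> \oo] --> (0 : R) ->
  \int[mu]_x f x = 0.
Proof.
move=> cf intf dF Fy FNy.
pose f_ n := ((f \_ `[- n%:R, n%:R]) : R -> R).
have mf : measurable_fun setT f by exact: continuous_measurable_fun.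
have cvg_f : (\int[mu]_x (f_ n x)%:E)%E @[n --> \oo] --> (\int[mu]_x (f x)%:E)%E.
  apply: (@dominated_cvg _ _ _ mu setT _ _ _ (fun x => `|f x|%:E)) => //.
  - move=> n; apply/measurable_EFinP.
    apply: (measurable_restrictT _ _).1 => //.
    exact: measurable_funTS.
  - move=> x _; apply: cvg_EFin; first by apply: nearW.
    apply: cvg_near_cst; near=> n.
    rewrite /= /f_ patchE mem_set//= in_itv/= -ler_norml.
    near: n; exact: nbhs_infty_ger.
  - exact: integrable_norm.
  - move=> n x _; rewrite lee_fin /f_ patchE; case: ifP => // _.
    by rewrite normr0.
have cvg_F : (\int[mu]_x (f_ n x)%:E)%E @[n --> \oo] --> (0%:E : \bar R).
  have : (F n%:R - F (- n%:R))%:E @[n --> \oo] --> (0%:E : \bar R).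
    apply: cvg_EFin; first by apply: nearW.
    by rewrite -[X in _ --> X](subr0 0); exact: cvgB.
  apply: cvg_trans; apply: near_eq_cvg; near=> n.
  have n0 : (0 < n)%N by near: n; exists 1%N.
  apply/esym; pose I : set R := `[- n%:R, n%:R]%classic.
  transitivity (\int[mu]_(x in I) (f x)%:E)%E.
    rewrite [RHS]integral_mkcond; apply: eq_integral => x _.
    by rewrite /f_ !patchE; case: ifP.
  rewrite (@continuous_FTC2 _ f F)// ?EFinB//.
  - by rewrite gtrN ?ltr0n.
  - exact: continuous_subspaceT.
  - split.
    + by move=> x _; case: (dF x).
    + apply: cvg_at_right_filter.
      have [+ _] := dF (- n%:R); move/derivable1_diffP/differentiable_continuous; exact.
    + apply: cvg_at_left_filter.
      have [+ _] := dF n%:R; move/derivable1_diffP/differentiable_continuous; exact.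
  - by move=> x _; rewrite derive1E; case: (dF x).
rewrite /Rintegral.
by rewrite (cvg_unique _ cvg_f cvg_F).
Unshelve. all: by end_near.
Qed.

(** With [t = x^2 / (2 s)] the Gaussian is [e^{-t} e^{-t}]. One factor absorbs the power, since
    [|x|^n <= 1 + (x^2)^(n+1)] and [t^(n+1) <= (n+1)! e^t]; the other is the wider Gaussian left on
    the right. *)
Lemma gauss_dominated s n : 0 < s ->
  exists C : R, 0 <= C /\ forall x, `|x ^+ n * expR (- x ^+ 2 / s)| <= C * expR (- x ^+ 2 / (s * 2)).
Proof.
move=> s0; exists (1 + (s * 2) ^+ n.+1 * n.+1`!%:R); split.
  by rewrite addr_ge0// mulr_ge0// exprn_ge0// mulr_ge0// ltW.
move=> x; set t := x ^+ 2 / (s * 2).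
have t0 : 0 <= t by rewrite divr_ge0 ?sqr_ge0// mulr_ge0// ltW.
have -> : - x ^+ 2 / s = - t + - t by rewrite /t; field; rewrite gt_eqF.
have -> : - x ^+ 2 / (s * 2) = - t by rewrite /t mulNr.
rewrite expRD mulrA normrM (ger0_norm (expR_ge0 _)) ler_wpM2r ?expR_ge0//.
rewrite normrM (ger0_norm (expR_ge0 _)) expRN ler_pdivrMr ?expR_gt0//.
have := @expR_ge1Dxn R t n t0; set e := expR t => he.
have fact0 : 0 < n.+1`!%:R :> R by rewrite ltr0n fact_gt0.
have e1 : 1 <= e by rewrite (le_trans _ he)// lerDl divr_ge0// ?exprn_ge0// ltW.
have te : t ^+ n.+1 <= n.+1`!%:R * e.
  rewrite mulrC -ler_pdivrMr//; apply: le_trans he; lra.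
have xn : `|x ^+ n| <= 1 + (s * 2) ^+ n.+1 * t ^+ n.+1.
  rewrite -exprMn /t (mulrC (s * 2)) divfK; last by rewrite gt_eqF// mulr_gt0.
  rewrite -exprM normrX -(@ger0_norm _ (x ^+ _)); last first.
    by rewrite exprM exprn_ge0// sqr_ge0.
  rewrite normrX; have [x1|x1] := leP `|x| 1.
    by rewrite (le_trans (exprn_ile1 _ _ _))// lerDl exprn_ge0.
  rewrite -[leLHS]add0r lerD// ler_weXn2l ?ltW//; lia.
apply: le_trans xn _; rewrite mulrDl mul1r lerD//.
by rewrite -mulrA ler_wpM2l// exprn_ge0// mulr_ge0// ltW.
Qed.

Lemma continuous_gauss s : continuous (fun x => expR (- x ^+ 2 / s)).
Proof.
move=> x; apply: (@continuous_comp _ _ _ (fun x => - x ^+ 2 / s) (@expR R)); last first.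
  exact: continuous_expR.
by apply: cvgMl; apply: cvgN; exact: exprn_continuous.
Qed.

(** The weight is a rescaled normal density of variance [s / 2], whose normalisation yields the
    total mass [sqrt (pi s)]. *)
Lemma gauss_normal_pdf s x : 0 < s ->
  expR (- x ^+ 2 / s) = Num.sqrt (pi * s) * normal_pdf 0 (Num.sqrt (s / 2)) x.
Proof.
move=> s0; have s20 : 0 < Num.sqrt (s / 2) by rewrite sqrtr_gt0 divr_gt0.
rewrite normal_pdfE ?gt_eqF// /normal_peak /normal_fun subr0 sqr_sqrtr; last first.
  by rewrite divr_ge0// ltW.
have -> : s / 2 * pi *+ 2 = pi * s by rewrite -mulr_natr; field.
have -> : s / 2 *+ 2 = s by rewrite -mulr_natr; field.
by rewrite mulVKf// gt_eqF// sqrtr_gt0 mulr_gt0// pi_gt0.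
Qed.

Lemma integral_gauss s : 0 < s ->
  (\int[mu]_x (expR (- x ^+ 2 / s))%:E)%E = (Num.sqrt (pi * s))%:E.
Proof.
move=> s0; under eq_integral do rewrite gauss_normal_pdf// EFinM.
rewrite integralZl//; last exact: integrable_normal_pdf.
by rewrite integral_normal_pdf mule1.
Qed.

Lemma integrable_gauss s : 0 < s ->
  mu.-integrable setT (fun x => (expR (- x ^+ 2 / s))%:E).
Proof.
move=> s0; apply/integrableP; split.
  by apply/measurable_EFinP; apply: continuous_measurable_fun; exact: continuous_gauss.
under eq_integral do rewrite /= ger0_norm ?expR_ge0//.
by rewrite integral_gauss// ltry.
Qed.

Lemma continuous_gauss_moment s n : continuous (fun x => x ^+ n * expR (- x ^+ 2 / s)).
Proof. by move=> x; apply: cvgM; [exact: exprn_continuous|exact: continuous_gauss]. Qed.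

Lemma integrable_gauss_moment s n : 0 < s ->
  mu.-integrable setT (EFin \o (fun x => x ^+ n * expR (- x ^+ 2 / s))).
Proof.
move=> s0; have [C [C0 hC]] := gauss_dominated s n s0.
have s20 : 0 < s * 2 by rewrite mulr_gt0.
apply: (@le_integrable _ _ _ mu setT _ _
    (fun x => (C%:E * (expR (- x ^+ 2 / (s * 2)))%:E)%E)) => //.
- apply/measurable_EFinP; apply: continuous_measurable_fun; exact: continuous_gauss_moment.
- move=> x _; rewrite -EFinM !abse_EFin lee_fin (le_trans (hC x))//.
  exact: ler_norm.
- by apply: integrableZl => //; exact: integrable_gauss.
Qed.

Definition gmoment s n : R := \int[mu]_x (x ^+ n * expR (- x ^+ 2 / s)).

Lemma gmoment0 s : 0 < s -> gmoment s 0 ^+ 2 = pi * s.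
Proof.
move=> s0; rewrite /gmoment /Rintegral.
under eq_integral do rewrite expr0 mul1r.
by rewrite integral_gauss//= sqr_sqrtr// mulr_ge0 ?pi_ge0// ltW.
Qed.

Lemma is_derive_gauss_moment s n x :
  is_derive x 1 (fun x : R => x ^+ n * expR (- x ^+ 2 / s))
    (n%:R * (x ^+ n.-1 * expR (- x ^+ 2 / s))
     - 2 / s * (x ^+ n.+1 * expR (- x ^+ 2 / s))).
Proof.
have dX k : is_derive x 1 (fun x : R => x ^+ k) (k%:R * x ^+ k.-1).
  split; first exact: exprn_derivable.
  by rewrite exp_derive scaler1 -mulr_natl.
have dQ : is_derive x 1 (fun x : R => - x ^+ 2 / s) (- (2 * x) / s).
  have -> : (fun x : R => - x ^+ 2 / s) = (- s^-1) \*: (fun x : R => x ^+ 2).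
    by apply/funext => y /=; rewrite mulNr mulrC -mulNr.
  apply: is_derive_eq; rewrite /GRing.scale /= expr1; ring.
have dG := @is_derive1_comp R (@expR R) (fun x => - x ^+ 2 / s) x _ _ (is_derive_expR _) dQ.
apply: (is_derive_eq (is_deriveM (dX n) dG)).
rewrite /GRing.scale /= (exprS x n); ring.
Qed.

(** Domination at exponent [n + 1] leaves a spare factor [1 / |u k|]. Constraining only [|u k|]
    covers both ends of the line. *)
Lemma cvg_gauss_moment s n (u : nat -> R) : 0 < s -> (forall k, `|u k| = k%:R) ->
  u k ^+ n * expR (- u k ^+ 2 / s) @[k --> \oo] --> (0 : R).
Proof.
move=> s0 hu; have [C [C0 hC]] := gauss_dominated s n.+1 s0.
have cvgC : C * k.+1%:R^-1 @[k --> \oo] --> (0 : R).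
  by rewrite -[X in _ --> X](mulr0 C); apply: cvgMr; exact: cvg_harmonic.
(* After the shift [|u k|] is [k + 1], so dividing by it is legitimate. *)
rewrite -(cvg_shiftS (fun k => u k ^+ n * expR (- u k ^+ 2 / s))).
apply/norm_cvg0P.
apply: (@squeeze_cvgr _ _ _ _ (cst 0) (fun k => C * k.+1%:R^-1)) => //.
  apply: nearW => k /=; rewrite normr_ge0 /= ler_pdivlMr ?ltr0n//.
  rewrite -hu mulrC -normrM mulrA -exprS (le_trans (hC _))// ler_piMr//.
  by rewrite expR_le1 mulNr oppr_le0 divr_ge0 ?sqr_ge0// mulr_ge0// ltW.
exact: cvg_cst.
Qed.

(** The derivative of [x^n e^{-x^2/s}] integrates to zero. At [n = 0] the truncated [n.-1] is
    multiplied by zero. Keeping 2 on the left states the recursion without division. *)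
Lemma gmomentS s n : 0 < s -> gmoment s n.+1 *+ 2 = s * (gmoment s n.-1 *+ n).
Proof.
move=> s0.
have iM k := integrable_gauss_moment s k s0.
pose f x := n%:R * (x ^+ n.-1 * expR (- x ^+ 2 / s))
     - 2 / s * (x ^+ n.+1 * expR (- x ^+ 2 / s)).
have i1 : mu.-integrable setT (EFin \o (fun x => n%:R * (x ^+ n.-1 * expR (- x ^+ 2 / s)))).
  by apply: (integrableZl measurableT n%:R (iM _)).
have i2 : mu.-integrable setT (EFin \o (fun x => 2 / s * (x ^+ n.+1 * expR (- x ^+ 2 / s)))).
  by apply: (integrableZl measurableT (2 / s) (iM _)).
have : \int[mu]_x f x = 0.
  apply: (@Rintegral_derive_eq0 f (fun x => x ^+ n * expR (- x ^+ 2 / s))).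
  - move=> x; apply: cvgB; apply: cvgMr; exact: continuous_gauss_moment.
  - exact: (integrableB measurableT i1 i2).
  - exact: is_derive_gauss_moment.
  - by apply: (@cvg_gauss_moment s n (fun k => k%:R)) => // k; rewrite normr_nat.
  - by apply: (@cvg_gauss_moment s n (fun k => - k%:R)) => // k; rewrite normrN normr_nat.
rewrite /f RintegralB// !RintegralZl// -/(gmoment s _) -/(gmoment s _) => /eqP.
rewrite subr_eq0 => /eqP h.
rewrite -[_ *+ n]mulr_natl h -mulr_natl; field; exact: lt0r_neq0.
Qed.

(** Tonelli applied to [|f| |g|] gives integrability, and Fubini then gives the value. *)
Lemma Rintegral_prod (f g : R -> R) :
  mu.-integrable setT (EFin \o f) -> mu.-integrable setT (EFin \o g) ->
  (@leb2 R).-integrable setT (EFin \o (fun p : R * R => f p.1 * g p.2)) /\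
  Rintegral (@leb2 R) setT (fun p : R * R => f p.1 * g p.2) =
  (\int[mu]_x f x) * \int[mu]_x g x.
Proof.
move=> intf intg.
have mf : measurable_fun setT f by apply/measurable_EFinP; exact: measurable_int intf.
have mg : measurable_fun setT g by apply/measurable_EFinP; exact: measurable_int intg.
have mfg : measurable_fun setT (EFin \o (fun p : R * R => f p.1 * g p.2)).
  apply/measurable_EFinP/measurable_funM.
    exact: (measurableT_comp mf measurable_fst).
  exact: (measurableT_comp mg measurable_snd).
have intfg : (@leb2 R).-integrable setT (EFin \o (fun p : R * R => f p.1 * g p.2)).
  apply/integrable12ltyP => //=.
  under eq_integral => x _.
    under eq_integral do rewrite normrM EFinM.
    rewrite integralZl//; last by have := integrable_norm intg.
    (* The finite inner integral becomes a real constant, which the outer integral can factor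
       out. *)
    rewrite -[X in (_ * X)%E]fineK; last first.
      by apply: integrable_fin_num => //; have := integrable_norm intg.
    over.
  rewrite integralZr//; last by have := integrable_norm intf.
  rewrite -[X in (X * _)%E]fineK ?ltry//.
  by apply: integrable_fin_num => //; have := integrable_norm intf.
split=> //; rewrite /Rintegral -integral12_prod_meas1// /fubini_F /=.
under eq_integral => x _.
  under eq_integral do rewrite EFinM.
  rewrite integralZl//.
  rewrite -[X in (_ * X)%E]fineK; last exact: integrable_fin_num.
  over.
rewrite integralZr// fineM//; exact: integrable_fin_num.
Qed.

End GaussianMoments.

(** * Combinatorial weights *)

(** Both sides are the coefficient of [x^l] in [((1 + x) - x)^k (1 + x)^m]. *)
Lemma sum_alt_bin_bin (R : pzRingType) (m k l : nat) :
  \sum_(p < l.+1) (-1) ^+ p * ('C(k, p) * 'C(m + k - p, l - p))%:R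
  = 'C(m, l)%:R :> R.
Proof.
elim: k m l => [|k IH] m l.
  rewrite big_ord_recl big1 => [|i _]; last by rewrite /= bin_small ?mulr0.
  by rewrite bin0 mul1n mul1r addr0 addn0 !subn0.
(* Pascal's rule on ['C(k.+1, p)], with [p] shifted by one in the second half. For [l = 0] that half
   is empty, so the truncated [l.-1] is harmless. *)
have -> : \sum_(p < l.+1) (-1) ^+ p * ('C(k.+1, p) * 'C(m + k.+1 - p, l - p))%:R
  = \sum_(p < l.+1) (-1) ^+ p * ('C(k, p) * 'C(m.+1 + k - p, l - p))%:R
  - \sum_(p < l) (-1) ^+ p * ('C(k, p) * 'C(m + k - p, l.-1 - p))%:R :> R.
  rewrite !big_ord_recl /= !bin0 !addnS addSn -addrA; congr (_ + _).
  rewrite -sumrB; apply: eq_bigr => i _; rewrite /bump /= add1n binS.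
  rewrite mulnDl natrD mulrDr subSS !subnS exprS; congr (_ + _).
  by rewrite -subn1 subnAC subn1 mulN1r mulNr.
case: l => [|l]; first by rewrite big_ord0 IH !bin0 subr0.
by rewrite /= !IH binS natrD addrK.
Qed.

Section Weights.
Variable R : realType.
Implicit Types (eta : R) (k l m n j E : nat).
Local Notation sqf n := (Num.sqrt (n`!%:R : R)).

Lemma natr_fact_neq0 n : (n`!%:R : R) != 0.
Proof. by rewrite pnatr_eq0 -lt0n fact_gt0. Qed.

Lemma sqf_gt0 n : 0 < sqf n.
Proof. by rewrite sqrtr_gt0 ltr0n fact_gt0. Qed.

Lemma sqf2 n : sqf n ^+ 2 = n`!%:R.
Proof. by rewrite sqr_sqrtr// ler0n. Qed.

(* Contribution of [A_kl rho_mn] to the expectation; for [m = l + j] and [n = k + j]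
   it equals [eta ^+ j * sqrt ('C(m, l) * 'C(n, k))]. *)
Definition weight eta k l m n : R :=
  if (m + k == n + l)%N then
    eta ^+ n / eta ^+ k * 'C(m, l)%:R * (sqf n * sqf l / (sqf k * sqf m))
  else 0.

(** Each term is [n! / k!] times a term of [sum_alt_bin_bin], as [m + k = n + l] turns [(n+l-p)!]
    into ['C(m+k-p, l-p) (l-p)! n!]. The factor [(n+l-p)!] is the one produced by the Gaussian
    moments. *)
Lemma sum_Laguerre_fact k l m n : (m + k = n + l)%N ->
  \sum_(p < (minn k l).+1)
     (-1) ^+ p * (n + l - p)`!%:R / (p`!%:R * (k - p)`!%:R * (l - p)`!%:R)
  = n`!%:R / k`!%:R * 'C(m, l)%:R :> R.
Proof.
move=> e; rewrite -(sum_alt_bin_bin _ m k l).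
have le_min : ((minn k l).+1 <= l.+1)%N by rewrite ltnS geq_minr.
rewrite (big_ord_widen _ (fun p => (-1) ^+ p * (n + l - p)`!%:R /
  (p`!%:R * (k - p)`!%:R * (l - p)`!%:R)) le_min) big_mkcond/= mulr_sumr.
apply: eq_bigr => -[p /= pl] _; case: ifPn => pk; last first.
  by rewrite bin_small ?mulr0//; lia.
have h1 : ('C(k, p) * (p`! * (k - p)`!) = k`!)%N by apply: bin_fact; lia.
have h2 : ('C(m + k - p, l - p) * ((l - p)`! * n`!) = (n + l - p)`!)%N.
  have -> : (n = m + k - p - (l - p))%N by lia.
  rewrite bin_fact; last lia.
  congr (_`!); lia.
rewrite -h1 -h2 !natrM.
have := natr_fact_neq0 k; rewrite -h1 !natrM !mulf_eq0 !negb_or => /and3P[c0 p0 q0].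
by field; rewrite ?natr_fact_neq0 ?c0 ?p0 ?q0.
Qed.

(** At [j = 1] this is an equality. Passing from [j + 1] to [j + 2] multiplies the left side by
    [eta (k+j+2) / (j+2)], at most 1 because [eta (k+j+2) <= eta E < 2 <= j + 2]. *)
Lemma pow_bin_le eta E k j : 0 < eta -> eta * E%:R < 2 -> (0 < j)%N -> (k + j <= E)%N ->
  eta ^+ j * 'C(k + j, k)%:R <= eta * k.+1%:R.
Proof.
move=> e0 eE; case: j => // j _; elim: j => [|j IH] kE.
  by rewrite expr1 addn1 binSn.
have {}IH := IH (ltnW _).
rewrite -(ler_pM2r (_ : 0 < j.+2%:R)) ?ltr0n//.
have -> : eta ^+ j.+2 * 'C(k + j.+2, k)%:R * j.+2%:R =
  (eta ^+ j.+1 * 'C(k + j.+1, k)%:R) * (eta * (k + j.+2)%:R) :> R.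
  rewrite [eta ^+ j.+2]exprSr -!mulrA; congr (_ * _).
  rewrite [RHS]mulrCA; congr (_ * _); rewrite -!natrM; congr (_%:R).
  have := mul_bin_diag (k + j.+2) j.+1.
  have -> : 'C(k + j.+2, j.+2) = 'C(k + j.+2, k).
    by rewrite -(bin_sub (leq_addr j.+2 k)); congr 'C(_, _); lia.
  have -> : 'C((k + j.+2).-1, j.+1) = 'C(k + j.+1, k).
    by rewrite -(bin_sub (leq_addr j.+1 k)); congr 'C(_, _); lia.
  lia.
apply: ler_pM.
- by rewrite mulr_ge0// exprn_ge0// ltW.
- by rewrite mulr_ge0// ltW.
- by apply: IH; lia.
apply: (@le_trans _ _ 2); last by rewrite ler_nat.
by apply: le_trans (ltW eE); rewrite ler_pM2l// ler_nat.
Qed.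

Lemma weight_ge0 eta k l m n : 0 < eta -> 0 <= weight eta k l m n.
Proof.
move=> e0; rewrite /weight; case: ifP => // _.
by rewrite !mulr_ge0 ?invr_ge0 ?mulr_ge0 ?exprn_ge0 ?sqrtr_ge0// ltW.
Qed.

Lemma weight_diag eta k l : 0 < eta -> weight eta k l l k = 1.
Proof.
move=> e0; rewrite /weight addnC eqxx binn.
have := sqf_gt0 k; have := sqf_gt0 l => /gt_eqF l0 /gt_eqF k0.
by field; rewrite l0 k0 expf_neq0// gt_eqF.
Qed.

(** With [j = m - l = n - k >= 1], the squared weight is the product of [eta^j 'C(m, l)] and
    [eta^j 'C(n, k)], and [pow_bin_le] bounds each factor. *)
Lemma weight_le eta E k l m n : 0 < eta -> eta * E%:R < 2 -> m != l ->
  (m <= E)%N -> (n <= E)%N ->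
  weight eta k l m n <= eta * Num.sqrt ((k.+1 * l.+1)%:R).
Proof.
move=> e0 eE ml mE nE.
have rhs0 : 0 <= eta * Num.sqrt ((k.+1 * l.+1)%:R) by rewrite mulr_ge0 ?sqrtr_ge0 ?ltW.
rewrite /weight; case: eqP => // e.
(* For [m < l] the binomial vanishes; from here on the subtraction [m - l] does not truncate. *)
have [mltl|lm] := ltnP m l; first by rewrite bin_small// mulr0 mul0r.
pose j := (m - l)%N.
have mE' : m = (l + j)%N by rewrite /j; lia.
have nE' : n = (k + j)%N by rewrite /j; lia.
have j0 : (0 < j)%N by rewrite /j; lia.
have p1 : eta ^+ j * 'C(m, l)%:R <= eta * l.+1%:R.
  by rewrite mE'; apply: pow_bin_le eE _ _ => //; lia.
have p2 : eta ^+ j * 'C(n, k)%:R <= eta * k.+1%:R.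
  by rewrite nE'; apply: pow_bin_le eE _ _ => //; lia.
rewrite -(@ler_pXn2r _ 2) ?nnegrE//; last first.
  by rewrite !mulr_ge0 ?invr_ge0 ?mulr_ge0 ?exprn_ge0 ?sqrtr_ge0// ltW.
have -> : (eta * Num.sqrt ((k.+1 * l.+1)%:R)) ^+ 2 = (eta * l.+1%:R) * (eta * k.+1%:R).
  by rewrite exprMn sqr_sqrtr ?ler0n// natrM; ring.
have -> : (eta ^+ n / eta ^+ k * 'C(m, l)%:R * (sqf n * sqf l / (sqf k * sqf m))) ^+ 2
  = (eta ^+ j * 'C(m, l)%:R) * (eta ^+ j * 'C(n, k)%:R).
  have -> : eta ^+ n / eta ^+ k = eta ^+ j.
    by rewrite nE' exprD mulrC mulKf// expf_neq0// gt_eqF.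
  rewrite !exprMn exprVn exprMn !sqf2.
  have h1 : ('C(m, l) * (l`! * j`!) = m`!)%N by rewrite /j; apply: bin_fact; lia.
  have h2 : ('C(n, k) * (k`! * j`!) = n`!)%N.
    by rewrite (_ : j = n - k)%N; [apply: bin_fact|]; lia.
  rewrite -h1 -h2 !natrM.
  have := natr_fact_neq0 m; rewrite -h1 !natrM !mulf_eq0 !negb_or => /and3P[c0 p0 q0].
  by field; rewrite ?natr_fact_neq0 ?c0.
by apply: ler_pM => //; rewrite mulr_ge0// exprn_ge0// ltW.
Qed.

End Weights.

(** * Density operators *)

Section Density.
Variable R : realType.
Local Notation C := R[i].
Implicit Types (z : C).

Lemma cabsE z : (cabs z)%:C = `|z|.
Proof. by rewrite normc_def. Qed.

Lemma cabs_ge0 z : 0 <= cabs z. Proof. exact: sqrtr_ge0. Qed.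

Lemma cabsM z1 z2 : cabs (z1 * z2) = cabs z1 * cabs z2.
Proof.
apply: (@complexI R).
by rewrite (rmorphM (real_complex R)) cabsE normrM -!cabsE.
Qed.

Lemma ler_cabs_sum (I : finType) (P : pred I) (F : I -> C) :
  cabs (\sum_(i | P i) F i) <= \sum_(i | P i) cabs (F i).
Proof.
rewrite -lecR cabsE (_ : (_)%:C = \sum_(i | P i) `|F i|) ?ler_norm_sum//.
by rewrite (rmorph_sum (real_complex R)); apply: eq_bigr => i _; rewrite -cabsE.
Qed.

Lemma cabs_real (x : R) : cabs x%:C = `|x|.
Proof. by rewrite /cabs /cmodsq /= expr0n addr0 sqrtr_sqr. Qed.

Lemma mulcJ z : z * conjc z = (cabs z ^+ 2)%:C.
Proof.
rewrite /cabs sqr_sqrtr /cmodsq; last by rewrite addr_ge0 ?sqr_ge0.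
by case: z => x y; simpc; rewrite /=; congr (_ +i* _); ring.
Qed.

(** Positivity is tested on [d a + c *: d b], where [c] is the phase that makes both cross terms
    equal to [-|rho a b|]. *)
Lemma density_entry_le E (rho : 'M[C]_E.+1) (a b : 'I_E.+1) : density_op rho ->
  cabs (rho a b) *+ 2 <= complex.Re (rho a a) + complex.Re (rho b b).
Proof.
case=> herm psd _.
have hba i j : rho j i = conjc (rho i j).
  by rewrite -[in LHS]herm /adjmx !mxE.
pose d i : 'cV[C]_E.+1 := delta_mx i ord0.
have dE i j : (adjmx (d i) *m rho *m d j) ord0 ord0 = rho i j.
  have -> : adjmx (d i) = delta_mx ord0 i :> 'M[C]_(1, E.+1).
    by apply/matrixP => u v; rewrite !mxE andbC rmorph_nat.
  by rewrite -rowE -colE !mxE.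
have qE c : (adjmx (d a + c *: d b) *m rho *m (d a + c *: d b)) ord0 ord0 =
    rho a a + c * rho a b + conjc c * rho b a + c * conjc c * rho b b.
  have -> : adjmx (d a + c *: d b) = adjmx (d a) + conjc c *: adjmx (d b).
    by apply/matrixP => u v; rewrite !mxE rmorphD rmorphM.
  rewrite !mulmxDl !mulmxDr -!scalemxAl -!scalemxAr.
  rewrite [LHS]mxE ![_ (_ + _) _ _]mxE ![_ (_ *: _) _ _]mxE !dE.
  ring.
set r := cabs (rho a b).
(* A zero entry has no phase; nonnegativity of the diagonal then suffices. *)
have [r0|r0] := eqVneq r 0.
  have := psd (d a); rewrite dE lecE => /andP[_ pa].
  have := psd (d b); rewrite dE lecE => /andP[_ pb].
  by rewrite r0 mul0rn addr_ge0.
have rC0 : r%:C != 0 by rewrite -(rmorph0 (real_complex R)) (inj_eq (@complexI R)).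
pose c : C := - conjc (rho a b) / r%:C.
have := psd (d a + c *: d b); rewrite qE (hba a b).
have zz := mulcJ (rho a b); rewrite -/r rmorphXn in zz.
have cJ : conjc c = - rho a b / r%:C.
  rewrite /c rmorphM rmorphN fmorphV; congr (- _ / _); first exact: conjcK.
  exact: conjc_real.
have -> : c * rho a b = - r%:C.
  by rewrite /c mulrAC mulNr (mulrC _ (rho a b)) zz expr2 mulNr mulfK.
have -> : conjc c * conjc (rho a b) = - r%:C.
  by rewrite cJ mulrAC mulNr zz expr2 mulNr mulfK.
have -> : c * conjc c = 1.
  rewrite cJ /c mulrACA mulrNN (mulrC _ (rho a b)) zz -invfM -expr2 divff//.
  by rewrite expf_neq0.
rewrite mul1r lecE => /andP[_].
case: (rho a a) (rho b b) => [x1 y1] [x2 y2] /=; lra.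
Qed.

Lemma density_diag_sum E (rho : 'M[C]_E.+1) : density_op rho ->
  \sum_i complex.Re (rho i i) = 1.
Proof.
case=> _ _ /(congr1 (@complex.Re R)) /=; rewrite /mxtrace => <-.
by rewrite (raddf_sum (@complex.Re R : Rcomplex R -> R)).
Qed.

Lemma density_diag_ge0 E (rho : 'M[C]_E.+1) i : density_op rho ->
  0 <= complex.Re (rho i i).
Proof.
move=> /(density_entry_le _ _ i i); rewrite -mulr2n ler_pMn2r//.
exact: le_trans (cabs_ge0 _).
Qed.

(** The line [m + k = n + l] meets each row and each column at most once. After [density_entry_le],
    the row terms and the column terms therefore each sum to at most the trace. *)
Lemma density_antidiag_le E (rho : 'M[C]_E.+1) (k l : 'I_E.+1) : density_op rho ->
  \sum_(m < E.+1) \sum_(n < E.+1 | (m + k == n + l)%N) cabs (rho m n) <= 1.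
Proof.
move=> drho; have d1 := density_diag_sum _ _ drho.
rewrite -(@ler_pMn2r _ 2)// -sumrMnl.
have -> : (1 *+ 2 : R) = \sum_i complex.Re (rho i i) + \sum_i complex.Re (rho i i).
  by rewrite d1 mulr2n.
apply: (@le_trans _ _ (\sum_(m < E.+1) \sum_(n < E.+1 | (m + k == n + l)%N)
   (complex.Re (rho m m) + complex.Re (rho n n)))).
  by apply: ler_sum => m _; rewrite -sumrMnl; apply: ler_sum => n _; apply: density_entry_le.
under eq_bigr do rewrite big_split; rewrite big_split/= lerD//.
  apply: ler_sum => m _; rewrite sumr_const -[leRHS]mulr1n.
  rewrite ler_wpMn2l ?density_diag_ge0//.
  apply/card_le1_eqP => n n' /eqP h /eqP h'.
  apply: val_inj => /=; lia.
rewrite (exchange_big_dep xpredT)//=.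
apply: ler_sum => n _; rewrite sumr_const -[leRHS]mulr1n.
rewrite ler_wpMn2l ?density_diag_ge0//.
apply/card_le1_eqP => m m' /eqP h /eqP h'.
apply: val_inj => /=; lia.
Qed.

End Density.

(** * Moment functional on bivariate polynomials *)

Section PolyFunctional.
Variables (K : comNzRingType) (g : nat -> K).
Implicit Types (A : nzRingType).

(** Formal integration: ['X^i] is replaced by the moment [g i]. The map [h] on coefficients allows
    nesting, one variable after the other. *)
Definition polymom A (h : A -> K) (p : {poly A}) : K :=
  \sum_(i < size p) h p`_i * g i.

Section Additive.
Variables (A : nzRingType) (h : {additive A -> K}).
Implicit Types (p q : {poly A}).

Lemma polymom_widen n p : (size p <= n)%N ->
  polymom A h p = \sum_(i < n) h p`_i * g i.
Proof.
move=> pn; rewrite /polymom (big_ord_widen _ (fun i => h p`_i * g i) pn) big_mkcond/=.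
apply: eq_bigr => i _; case: ltnP => // pi.
by rewrite nth_default// raddf0 mul0r.
Qed.

Lemma polymom_is_additive : additive (polymom A h).
Proof.
move=> p q; pose n := maxn (size p) (size q).
rewrite !(@polymom_widen n) ?leq_maxl ?leq_maxr//; last first.
  by rewrite (leq_trans (size_polyD _ _))// size_polyN.
rewrite -sumrB; apply: eq_bigr => i _.
by rewrite coefB raddfB mulrBl.
Qed.

(** Integration by parts in algebraic form: the moment recursion, extended linearly from monomials
    to polynomials. *)
Lemma polymomXM s p : (forall n, g n.+1 *+ 2 = s * (g n.-1 *+ n)) ->
  polymom A h ('X * p) *+ 2 = s * polymom A h p^`().
Proof.
move=> hg; rewrite (@polymom_widen (size p).+1); last first.
  by rewrite (leq_trans (size_polyMleq _ _))// size_polyX.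
rewrite big_ord_recl coefXM /= raddf0 mul0r add0r.
rewrite (@polymom_widen (size p)); last exact: leq_trans (size_poly _ _) (leq_pred _).
transitivity (\sum_(i < size p) s * (h p`_i * g i.-1 *+ i)).
  rewrite -sumrMnl; apply: eq_bigr => i _.
  by rewrite coefXM /= /bump leq0n add1n add0n -[LHS]mulrnAr hg mulrCA !mulrnAr.
case pn : (size p) => [|n]; first by rewrite !big_ord0 mulr0.
(* Indices shift by one: the term [i = 0] has factor 0 on the left, and the top term on the right is
   a coefficient beyond the degree. *)
rewrite big_ord_recl mulr0n mulr0 add0r [in RHS]big_ord_recr /= coef_deriv.
rewrite [p`_n.+1]nth_default ?pn// mul0rn raddf0 mul0r addr0 mulr_sumr.
apply: eq_bigr => i _; congr (_ * _).
by rewrite coef_deriv raddfMn mulrnAl.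
Qed.

Lemma polymomCM (c : A) p (k : K) : (forall a, h (c * a) = k * h a) ->
  polymom A h (c%:P * p) = k * polymom A h p.
Proof.
move=> hc; rewrite (@polymom_widen (size p)); last first.
  by rewrite mul_polyC size_scale_leq.
rewrite /polymom mulr_sumr; apply: eq_bigr => i _.
by rewrite coefCM hc mulrA.
Qed.

End Additive.
End PolyFunctional.

(** Differentiating the coefficients is the partial derivative in the inner variable; this is its
    product rule. *)
Lemma map_deriv_mul (K : comNzRingType) (P Q : {poly {poly K}}) :
  map_poly deriv (P * Q) = map_poly deriv P * Q + P * map_poly deriv Q.
Proof.
apply/polyP => i; rewrite coef_map coefD !coefM /= raddf_sum -big_split /=.
by apply: eq_bigr => j _; rewrite derivM !coef_map.
Qed.

Lemma derivation_exp (B : comNzRingType) (D : B -> B) :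
  (forall x y, D (x * y) = D x * y + x * D y) ->
  forall x n, D (x ^+ n) = x ^+ n.-1 * D x *+ n.
Proof.
move=> DM x; elim=> [|n IH].
  (* The product rule at [1 * 1] forces [D 1 = 0]. *)
  have := DM 1 1; rewrite expr0 mulr0n !mulr1 mul1r => /eqP.
  by rewrite -subr_eq0 opprD addrA subrr sub0r oppr_eq0 => /eqP.
rewrite exprS DM IH /= mulrS; congr (_ + _); first by rewrite mulrC.
case: n {IH} => [|n]; first by rewrite !mulr0n mulr0.
by rewrite mulrnAr /= mulrA -exprS.
Qed.

(** * Gaussian moments of powers of a complex variable and its conjugate, by algebraic recursion *)

Section GaussianFunctional.
Variables (K : numDomainType) (im : K) (s : K) (g : nat -> K).
Hypothesis im2 : im * im = -1.
Hypothesis gS : forall n, g n.+1 *+ 2 = s * (g n.-1 *+ n).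
Implicit Types (P Q : {poly {poly K}}) (c d : K).

(* A polynomial [P : {poly {poly K}}] in two real coordinates: [x] is the inner
   variable ['X%:P] and [y] the outer variable ['X]. *)
Definition mom1 : {poly K} -> K := polymom K g K id.
HB.instance Definition _ := GRing.isAdditive.Build _ _ mom1
  (polymom_is_additive K g K idfun).
Definition mom2 : {poly {poly K}} -> K := polymom K g {poly K} mom1.
HB.instance Definition _ := GRing.isAdditive.Build _ _ mom2
  (polymom_is_additive K g {poly K} mom1).

(** The form [x + c y]: [c = im] gives [z], and [c = - im] gives its conjugate. *)
Definition plin c : {poly {poly K}} := 'X%:P + c%:P%:P * 'X.

(** The derivation [d_x + c d_y], dual to multiplication by [plin c] under the Gaussian
    functional. *)
Definition dlin c P : {poly {poly K}} := map_poly deriv P + c%:P%:P * P^`().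

Lemma mom2C c P : mom2 (c%:P%:P * P) = c * mom2 P.
Proof.
apply: (polymomCM K g {poly K} mom1) => a.
exact: (polymomCM K g K idfun).
Qed.

Lemma mom2Y P : mom2 ('X * P) *+ 2 = s * mom2 P^`().
Proof. exact: (polymomXM K g {poly K} mom1). Qed.

Lemma mom2X P : mom2 ('X%:P * P) *+ 2 = s * mom2 (map_poly deriv P).
Proof.
rewrite /mom2 (@polymom_widen K g {poly K} mom1 (size P)); last first.
  by rewrite mul_polyC size_scale_leq.
rewrite (@polymom_widen K g {poly K} mom1 (size P)); last exact: size_poly.
rewrite -sumrMnl mulr_sumr; apply: eq_bigr => i _.
rewrite coefCM coef_map mulrA -mulrnAl; congr (_ * _).
exact: (polymomXM K g K idfun).
Qed.

Lemma dlinM c P Q : dlin c (P * Q) = dlin c P * Q + P * dlin c Q.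
Proof. rewrite /dlin map_deriv_mul derivM; ring. Qed.

Lemma mom2_dlin c P : mom2 (plin c * P) *+ 2 = s * mom2 (dlin c P).
Proof.
rewrite /dlin /plin mulrDl !raddfD /= -mulrA !mom2C mulrnDl -mulrnAr mom2Y mom2X.
by rewrite mulrDr mulrCA.
Qed.

Lemma map_derivX : map_poly deriv ('X : {poly {poly K}}) = 0.
Proof.
apply/polyP => i; rewrite coef_map coefX coef0 /=.
by case: (_ == _); rewrite ?linear0// -polyC1 derivC.
Qed.

(** For [c] and [d] among [im] and [- im], the constant is 0 when [c = d] and 2 when they are
    opposite. *)
Lemma dlin_plin c d : dlin c (plin d) = (1 + c * d)%:P%:P.
Proof.
rewrite /dlin /plin raddfD /= map_deriv_mul !map_polyC /= map_derivX derivX.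
rewrite derivD derivM !derivC derivX polyC0 mul0r mulr0 !addr0 mulr1 !add0r.
by rewrite !polyCD !polyCM.
Qed.

Lemma plin_exp_eval c d a b (x y : K) :
  (plin c ^+ a * plin d ^+ b).[y%:P].[x] = (x + c * y) ^+ a * (x + d * y) ^+ b.
Proof.
have pE e : (plin e).[y%:P].[x] = x + e * y.
  by rewrite /plin hornerD hornerM !hornerC hornerX hornerD hornerM hornerX !hornerC.
by rewrite hornerM !horner_exp hornerM !horner_exp !pE.
Qed.

Definition mZ a b := mom2 (plin im ^+ a * plin (- im) ^+ b).

Lemma mZ00 : mZ 0 0 = g 0 ^+ 2.
Proof.
rewrite /mZ !expr0 mulr1 /mom2 /polymom size_poly1 big_ord1 coef1 /=.
by rewrite /mom1 /polymom size_poly1 big_ord1 coef1 /= mul1r expr2.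
Qed.

(** One factor [z] is traded for [dlin im], which kills [z^a] and lowers the conjugate power with a
    factor [2 b]; the 2 cancels against that of [mom2_dlin]. *)
Lemma mZS a b : mZ a.+1 b = s * mZ a b.-1 *+ b.
Proof.
apply: (@pmulrnI _ 2) => //; rewrite /mZ exprS -mulrA mom2_dlin dlinM.
rewrite !(derivation_exp _ _ (dlinM _)) !dlin_plin im2 subrr !polyC0 mulr0 mul0rn.
rewrite mul0r add0r mulrN im2 opprK mulrnAr raddfMn /= mulrA [X in mom2 X]mulrC.
by rewrite mom2C -[1 + 1]/(2%:R) mulr_natl mulrnAr mulrnAr mulrnAC.
Qed.

Lemma mZSr b : mZ 0 b.+1 = 0.
Proof.
apply: (@pmulrnI _ 2) => //; rewrite mul0rn /mZ expr0 mul1r exprS mom2_dlin.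
rewrite (derivation_exp _ _ (dlinM _)) !dlin_plin mulrNN im2 subrr !polyC0 mulr0.
by rewrite mul0rn raddf0 mulr0.
Qed.

(** The recursion lowers both exponents together, so unequal ones end at a vanishing moment. *)
Lemma mZE a b : mZ a b = if a == b then s ^+ a * a`!%:R * g 0 ^+ 2 else 0.
Proof.
elim: a b => [|a IH] [|b].
- by rewrite mZ00 /= expr0 !mul1r.
- by rewrite mZSr.
- by rewrite mZS mulr0n.
rewrite mZS /= IH eqSS; case: eqP => [->|_]; last by rewrite mulr0 mul0rn.
rewrite (exprS s) factS natrM -mulr_natr; ring.
Qed.

End GaussianFunctional.

(** * Complex-valued integrals *)

Section ComplexIntegral.
Variable R : realType.
Local Notation C := R[i].
Implicit Types (f g : C -> C) (v w c : C).

Definition cRe f := fun p : R * R => complex.Re (f (p.1 +i* p.2)).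
Definition cIm f := fun p : R * R => complex.Im (f (p.1 +i* p.2)).

(** Integrability of both parts travels with the value because linearity of the integral requires
    it. *)
Definition has_cintegral f v :=
  [/\ (@leb2 R).-integrable setT (EFin \o cRe f),
      (@leb2 R).-integrable setT (EFin \o cIm f) & cintegral f = v].

Lemma cintegralE f : cintegral f =
  (Rintegral (@leb2 R) setT (cRe f)) +i* (Rintegral (@leb2 R) setT (cIm f)).
Proof. by rewrite /cintegral [RHS]complexE. Qed.

Lemma has_cintegralD f g v w : has_cintegral f v -> has_cintegral g w ->
  has_cintegral (fun z => f z + g z) (v + w).
Proof.
move=> [rf jf <-] [rg jg <-].
have reE : cRe (fun z => f z + g z) = fun p => cRe f p + cRe g p.
  by apply/funext => p; rewrite /cRe; case: (f _) (g _) => [? ?] [? ?].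
have imE : cIm (fun z => f z + g z) = fun p => cIm f p + cIm g p.
  by apply/funext => p; rewrite /cIm; case: (f _) (g _) => [? ?] [? ?].
split.
- rewrite reE; exact: (integrableD measurableT rf rg).
- rewrite imE; exact: (integrableD measurableT jf jg).
- by rewrite !cintegralE reE imE !RintegralD.
Qed.

Lemma has_cintegralZ f v c : has_cintegral f v ->
  has_cintegral (fun z => c * f z) (c * v).
Proof.
case: c => a b [rf jf <-].
have reE : cRe (fun z => (a +i* b) * f z) = fun p => a * cRe f p - b * cIm f p.
  by apply/funext => p; rewrite /cRe /cIm; case: (f _) => [? ?].
have imE : cIm (fun z => (a +i* b) * f z) = fun p => a * cIm f p + b * cRe f p.
  by apply/funext => p; rewrite /cRe /cIm; case: (f _) => [? ?].
have i1 k : (@leb2 R).-integrable setT (EFin \o (fun p => k * cRe f p)).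
  exact: (integrableZl measurableT k rf).
have i2 k : (@leb2 R).-integrable setT (EFin \o (fun p => k * cIm f p)).
  exact: (integrableZl measurableT k jf).
split.
- rewrite reE; exact: (integrableB measurableT (i1 a) (i2 b)).
- rewrite imE; exact: (integrableD measurableT (i2 a) (i1 b)).
- by rewrite !cintegralE reE imE RintegralB// RintegralD// !RintegralZl.
Qed.

Lemma has_cintegral_sum (I : Type) (r : seq I) (P : pred I) (F : I -> C -> C) (V : I -> C) :
  (forall i, P i -> has_cintegral (F i) (V i)) ->
  has_cintegral (fun z => \sum_(i <- r | P i) F i z) (\sum_(i <- r | P i) V i).
Proof.
move=> FV; elim: r => [|i r IH].
  under [X in has_cintegral X _]funext do rewrite big_nil.
  rewrite big_nil.
  split; [exact: integrable0|exact: integrable0|].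
  by rewrite cintegralE /cRe /cIm /= Rintegral_cst// mul0r.
under [X in has_cintegral X _]funext do rewrite big_cons.
rewrite big_cons; case: ifP => // Pi; apply: has_cintegralD => //; exact: FV.
Qed.

End ComplexIntegral.

(** * Gaussian integrals over the complex plane *)

Section Gaussian2D.
Variables (R : realType) (s : R).
Hypothesis s0 : 0 < s.
Local Notation C := R[i].
Local Notation G z := ((expR (- cmodsq z / s))%:C).
Local Notation g := (fun n => (gmoment R s n)%:C).

(** The Gaussian factors over the real and imaginary parts, so the integral is a product of two
    moments on the line. *)
Lemma has_cintegral_monomial i j :
  has_cintegral R
    (fun z => (complex.Re z)%:C ^+ i * (complex.Im z)%:C ^+ j * G z) (g i * g j).
Proof.
pose w n (x : R) := x ^+ n * expR (- x ^+ 2 / s).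
have fE z : (complex.Re z)%:C ^+ i * (complex.Im z)%:C ^+ j * G z =
    (w i (complex.Re z) * w j (complex.Im z))%:C.
  rewrite /w /cmodsq opprD mulrDl expRD !(rmorphM (real_complex R)).
  rewrite !(rmorphXn (real_complex R)) /=; ring.
have [iw Ew] := Rintegral_prod R (w i) (w j) (integrable_gauss_moment R s i s0)
  (integrable_gauss_moment R s j s0).
have -> : (fun z => (complex.Re z)%:C ^+ i * (complex.Im z)%:C ^+ j * G z) =
    fun z : C => (w i (complex.Re z) * w j (complex.Im z))%:C.
  by apply/funext => z; rewrite fE.
split.
- exact: iw.
- have -> : EFin \o cIm R (fun z => (w i (complex.Re z) * w j (complex.Im z))%:C) = cst 0%E by [].
  exact: integrable0.
rewrite cintegralE /cRe /cIm /= Ew Rintegral_cst// mul0r.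
by rewrite -(rmorphM (real_complex R)).
Qed.

Lemma has_cintegral_poly (P : {poly {poly C}}) :
  has_cintegral R
    (fun z => P.[(complex.Im z)%:C%:P].[(complex.Re z)%:C] * G z) (mom2 C g P).
Proof.
have -> : (fun z => P.[(complex.Im z)%:C%:P].[(complex.Re z)%:C] * G z) =
  fun z => \sum_(j < size P) \sum_(i < size P`_j) P`_j`_i *
    ((complex.Re z)%:C ^+ i * (complex.Im z)%:C ^+ j * G z).
  apply/funext => z; rewrite (horner_coef P) horner_sum mulr_suml.
  apply: eq_bigr => j _; rewrite hornerM horner_exp hornerC (horner_coef P`_j).
  by rewrite !mulr_suml; apply: eq_bigr => i _; rewrite !mulrA.
have -> : mom2 C g P = \sum_(j < size P) \sum_(i < size P`_j) P`_j`_i * (g i * g j).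
  apply: eq_bigr => j _; rewrite mulr_suml; apply: eq_bigr => i _.
  by rewrite mulrA.
apply: has_cintegral_sum => j _; apply: has_cintegral_sum => i _.
apply: has_cintegralZ; exact: has_cintegral_monomial.
Qed.

Lemma has_cintegral_gauss a b :
  has_cintegral R (fun z => z ^+ a * conjc z ^+ b * G z)
    (if a == b then (s ^+ a * a`!%:R * (pi * s))%:C else 0).
Proof.
have -> : (fun z : C => z ^+ a * conjc z ^+ b * G z) =
  fun z => (plin C 'i%C ^+ a * plin C (- 'i%C) ^+ b).[(complex.Im z)%:C%:P].[(complex.Re z)%:C] * G z.
  apply/funext => z; congr (_ * _).
  rewrite plin_exp_eval.
  congr (_ ^+ _ * _ ^+ _); first exact: complexE.
  by case: z => x y; simpc.
have -> : (if a == b then (s ^+ a * a`!%:R * (pi * s))%:C else 0) =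
    mom2 C g (plin C 'i%C ^+ a * plin C (- 'i%C) ^+ b).
  have := mZE C 'i%C s%:C g; rewrite /mZ => -> //.
  - case: ifP => // _; rewrite -gmoment0// !(rmorphM (real_complex R)).
    by rewrite !(rmorphXn (real_complex R)) (rmorph_nat (real_complex R)).
  - by rewrite -expr2 sqr_i.
  - move=> n; rewrite -!(rmorphMn (real_complex R)) -(rmorphM (real_complex R)).
    by rewrite gmomentS.
exact: has_cintegral_poly.
Qed.

End Gaussian2D.

(** * Heterodyne expectation *)

(** Stated over an abstract field so that roots and exponentials are atoms: [r] stands for
    [sqrt eta], [sm] and [sn] for [sqrt m!] and [sqrt n!], and [e], [e'], [f] for exponentials. *)
Lemma heterodyne_term_rearrange (K : fieldType) (q et sm sn r z zb e e' f c : K)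
    (k l m n p : nat) :
  r ^+ 2 = et -> r != 0 -> sm != 0 -> sn != 0 -> (p <= k)%N -> (p <= l)%N ->
  q * (e * zb ^+ m / sm * (e' * z ^+ n / sn)) *
    (et^-1 * f * (r ^+ (k + l))^-1 * (c * (z / r) ^+ (l - p) * (zb / r) ^+ (k - p))) =
  q * et^-1 / (sm * sn) * c / et ^+ (k + l - p) *
    (z ^+ (n + l - p) * zb ^+ (m + k - p) * (e * e' * f)).
Proof.
move=> rE r0 sm0 sn0 pk pl.
(* The exponents of [r] add up to [2 (k + l - p)]. *)
have -> : et ^+ (k + l - p) = r ^+ (k + l) * r ^+ (l - p) * r ^+ (k - p).
  by rewrite -rE -exprM -!exprD; congr (_ ^+ _); lia.
have -> : (n + l - p = n + (l - p))%N by lia.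
have -> : (m + k - p = m + (k - p))%N by lia.
have et0 : et != 0 by rewrite -rE expf_neq0.
rewrite !expr_div_n !exprD.
have := expf_neq0 (k + l) r0; have := expf_neq0 (l - p) r0; have := expf_neq0 (k - p) r0.
rewrite exprD.
have := expf_neq0 k r0; have := expf_neq0 l r0.
move: (r ^+ k) (r ^+ l) (r ^+ (l - p)) (r ^+ (k - p)) => a b c' d.
move: (z ^+ n) (z ^+ (l - p)) (zb ^+ m) (zb ^+ (k - p)) => z1 z2 z3 z4.
move=> b0 a0 d0 c0 _.
by field; rewrite ?a0 ?b0 ?c0 ?d0 ?et0 ?sm0 ?sn0.
Qed.

Lemma heterodyne_regroup (K : comNzRingType) (q u r v f a s L : K) :
  q * (u * r * v) * (f * (a * s * L)) = a * (r * (q * (u * v) * (f * s * L))).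
Proof. ring. Qed.

Section Heterodyne.
Variables (R : realType) (eta : R).
Hypothesis eta0 : 0 < eta.
Local Notation C := R[i].
Local Notation sqf n := (Num.sqrt (n`!%:R : R)).

(** Coefficient of [z^(n+l-p) (conj z)^(m+k-p) e^{-|z|^2/eta}] in [heterodyne_term]. *)
Definition term_coef (k l m n p : nat) : R :=
  pi^-1 / eta / (sqf m * sqf n) *
  (sqf k * sqf l * (-1) ^+ p / (p`!%:R * (k - p)`!%:R * (l - p)`!%:R))
  / eta ^+ (k + l - p).

(** The factor of [A k l * rho m n] in the integrand [husimi * fA]. *)
Definition heterodyne_term (k l m n : nat) (z : C) : C :=
  (pi^-1)%:C * (conjc (coh z m) * coh z n) *
  ((eta^-1)%:C * (expR ((1 - eta^-1) * cmodsq z))%:C *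
   (Num.sqrt (eta ^+ (k + l)))%:C^-1 * Lpoly k l (z / (Num.sqrt eta)%:C)).

Lemma sqrtrXn (x : R) n : 0 <= x -> Num.sqrt (x ^+ n) = Num.sqrt x ^+ n.
Proof.
move=> x0; rewrite -[in LHS](sqr_sqrtr x0) -exprM mulnC exprM sqrtr_sqr.
by rewrite ger0_norm// exprn_ge0// sqrtr_ge0.
Qed.

(** Each coherent amplitude contributes [-|z|^2/2] to the exponent; with [(1 - 1/eta) |z|^2] from
    [fA] the total is [-|z|^2/eta]. *)
Lemma heterodyne_termE k l m n z : heterodyne_term k l m n z =
  \sum_(p < (minn k l).+1) (term_coef k l m n p)%:C *
    (z ^+ (n + l - p) * conjc z ^+ (m + k - p) * (expR (- cmodsq z / eta))%:C).
Proof.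
rewrite /heterodyne_term /Lpoly !mulr_sumr; apply: eq_bigr => -[p /= pkl] _.
have pk : (p <= k)%N by move: pkl; rewrite ltnS leq_min => /andP[].
have pl : (p <= l)%N by move: pkl; rewrite ltnS leq_min => /andP[].
set c := (_ / (p`!%:R * _ * _)).
have cohJ : conjc (coh z m) = (expR (- cmodsq z / 2))%:C * conjc z ^+ m / (sqf m)%:C.
  rewrite /coh !(rmorphM (@conjc R)) (fmorphV (@conjc R)) (rmorphXn (@conjc R)).
  by congr (_ * _ / _); exact: conjc_real.
have divJ : conjc (z / (Num.sqrt eta)%:C) = conjc z / (Num.sqrt eta)%:C.
  rewrite (rmorphM (@conjc R)) (fmorphV (@conjc R)).
  by congr (_ / _); exact: conjc_real.
have neq0 (x : R) : 0 < x -> x%:C != 0.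
  move=> x0; rewrite -(rmorph0 (real_complex R)) (inj_eq (@complexI R)).
  by rewrite gt_eqF.
have expE : (expR (- cmodsq z / eta))%:C = (expR (- cmodsq z / 2))%:C *
    (expR (- cmodsq z / 2))%:C * (expR ((1 - eta^-1) * cmodsq z))%:C.
  rewrite -!(rmorphM (real_complex R)) -!expRD; congr ((expR _)%:C).
  by field; rewrite gt_eqF.
have sqE : (Num.sqrt (eta ^+ (k + l)))%:C = (Num.sqrt eta)%:C ^+ (k + l).
  by rewrite sqrtrXn ?ltW// (rmorphXn (real_complex R)).
have cE : (term_coef k l m n p)%:C =
  (pi^-1)%:C * (eta%:C)^-1 / ((sqf m)%:C * (sqf n)%:C) * c%:C / eta%:C ^+ (k + l - p).
  rewrite /term_coef -/c !(rmorphM (real_complex R)) !(fmorphV (real_complex R)).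
  by rewrite (rmorphM (real_complex R)) !(rmorphXn (real_complex R)).
have etaV : (eta^-1)%:C = (eta%:C)^-1 by rewrite (fmorphV (real_complex R)).
have sq2 : (Num.sqrt eta)%:C ^+ 2 = eta%:C.
  by rewrite -(rmorphXn (real_complex R)) sqr_sqrtr// ltW.
rewrite cohJ divJ expE sqE cE etaV /coh.
apply: heterodyne_term_rearrange => //; apply: neq0; rewrite ?sqrtr_gt0//.
Qed.

(** The power [eta^(n+l-p) / eta^(k+l-p)] does not depend on [p], and [pi * eta] cancels the
    normalisation. What remains is [sum_Laguerre_fact]. *)
Lemma sum_term_coef k l m n :
  \sum_(p < (minn k l).+1) term_coef k l m n p *
    (if (n + l - p == m + k - p)%N
     then eta ^+ (n + l - p) * (n + l - p)`!%:R * (pi * eta) else 0)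
  = weight R eta k l m n.
Proof.
rewrite /weight; case: eqP => e; last first.
  (* As [p <= minn k l], no subtraction truncates, so the test on exponents is the same as
     [m + k = n + l]. *)
  rewrite big1// => -[p /= pkl] _; rewrite ifN ?mulr0//.
  have := geq_minl k l; have := geq_minr k l; lia.
have et0 : eta != 0 by rewrite gt_eqF.
transitivity (eta ^+ n / eta ^+ k * (sqf k * sqf l / (sqf m * sqf n)) *
  (n`!%:R / k`!%:R * 'C(m, l)%:R)).
  rewrite -(sum_Laguerre_fact R k l m n e) mulr_sumr.
  apply: eq_bigr => -[p /= pkl] _.
  have pk : (p <= k)%N by move: pkl; rewrite ltnS leq_min => /andP[].
  have pl : (p <= l)%N by move: pkl; rewrite ltnS leq_min => /andP[].
  rewrite -e eqxx /term_coef e.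
  have -> : (n + l - p = n + (l - p))%N by lia.
  have -> : (k + l - p = k + (l - p))%N by lia.
  rewrite !exprD.
  have pi0 : (pi : R) != 0 by rewrite gt_eqF// pi_gt0.
  have := expf_neq0 k et0; have := expf_neq0 (l - p) et0.
  have := natr_fact_neq0 R p; have := natr_fact_neq0 R (k - p); have := natr_fact_neq0 R (l - p).
  have := lt0r_neq0 (sqf_gt0 R m); have := lt0r_neq0 (sqf_gt0 R n).
  move: (sqf m) (sqf n) (sqf k) (sqf l) => a b c d.
  move: (eta ^+ k) (eta ^+ (l - p)) (eta ^+ n) => u v w.
  move: (p`!%:R : R) ((k - p)`!%:R : R) ((l - p)`!%:R : R) => f1 f2 f3.
  move: ((-1) ^+ p : R) ((n + (l - p))`!%:R : R) (pi : R) pi0 => sg f4 pp pi0.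
  move=> h1 h2 h3 h4 h5 h6 h7.
  by field; rewrite ?h1 ?h2 ?h3 ?h4 ?h5 ?h6 ?h7 ?et0 ?pi0.
have -> : n`!%:R / k`!%:R = sqf n ^+ 2 / sqf k ^+ 2 by rewrite !sqf2.
have := expf_neq0 k et0; have := lt0r_neq0 (sqf_gt0 R k).
have := lt0r_neq0 (sqf_gt0 R m); have := lt0r_neq0 (sqf_gt0 R n).
move: (sqf m) (sqf n) (sqf k) (sqf l) => a b c d.
move: (eta ^+ k) (eta ^+ n) ('C(m, l)%:R : R) => u v w h1 h2 h3 h4.
by field; rewrite ?h1 ?h2 ?h3 ?h4.
Qed.

Lemma has_cintegral_term k l m n :
  has_cintegral R (heterodyne_term k l m n) (weight R eta k l m n)%:C.
Proof.
have -> : heterodyne_term k l m n = fun z =>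
  \sum_(p < (minn k l).+1) (term_coef k l m n p)%:C *
    (z ^+ (n + l - p) * conjc z ^+ (m + k - p) * (expR (- cmodsq z / eta))%:C).
  by apply/funext => z; exact: heterodyne_termE.
have -> : (weight R eta k l m n)%:C = \sum_(p < (minn k l).+1)
    (term_coef k l m n p)%:C * (if (n + l - p == m + k - p)%N
     then (eta ^+ (n + l - p) * (n + l - p)`!%:R * (pi * eta))%:C else 0).
  rewrite -sum_term_coef (rmorph_sum (real_complex R)); apply: eq_bigr => p _.
  by rewrite (rmorphM (real_complex R)); congr (_ * _); case: ifP.
apply: has_cintegral_sum => p _; apply: has_cintegralZ.
exact: has_cintegral_gauss.
Qed.

Lemma heterodyne_expectE E (A : nat -> nat -> C) (rho : 'M[C]_E.+1) :
  heterodyne_expect rho (fun alpha => fA E A alpha eta) =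
  \sum_(k < E.+1) \sum_(l < E.+1) A k l *
    \sum_(m < E.+1) \sum_(n < E.+1) rho m n * (weight R eta k l m n)%:C.
Proof.
rewrite /heterodyne_expect.
have -> : (fun alpha => husimi rho alpha * fA E A alpha eta) = fun z =>
  \sum_(k < E.+1) \sum_(l < E.+1) A k l *
    \sum_(m < E.+1) \sum_(n < E.+1) rho m n * heterodyne_term k l m n z.
  apply/funext => z; rewrite /fA.
  rewrite mulr_sumr mulr_sumr; apply: eq_bigr => k _.
  rewrite mulr_sumr mulr_sumr; apply: eq_bigr => l _.
  rewrite /husimi /heterodyne_term; move: (Lpoly k l _) => L.
  rewrite mulr_sumr mulr_suml mulr_sumr; apply: eq_bigr => m _.
  rewrite mulr_sumr mulr_suml mulr_sumr; apply: eq_bigr => n _.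
  exact: heterodyne_regroup.
suff [] : has_cintegral R (fun z => \sum_(k < E.+1) \sum_(l < E.+1) A k l *
    \sum_(m < E.+1) \sum_(n < E.+1) rho m n * heterodyne_term k l m n z)
  (\sum_(k < E.+1) \sum_(l < E.+1) A k l *
    \sum_(m < E.+1) \sum_(n < E.+1) rho m n * (weight R eta k l m n)%:C) by [].
apply: has_cintegral_sum => k _; apply: has_cintegral_sum => l _.
apply: has_cintegralZ; apply: has_cintegral_sum => m _.
apply: has_cintegral_sum => n _; apply: has_cintegralZ.
exact: has_cintegral_term.
Qed.

End Heterodyne.

(** * Bias bound, one matrix element of the operator at a time *)

Theorem theorem1 (R : realType) (E : nat) (eta : R)
  (A : nat -> nat -> R[i]) (rho : 'M[R[i]]_(E.+1)) :
  0 < eta -> eta < 1 -> eta * E%:R < 2 ->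
  density_op rho ->
  cabs (trace_A_rho A rho
        - heterodyne_expect rho (fun alpha => fA E A alpha eta))
    <= eta * KA E A.
Proof.
move=> eta0 _ etaE drho.
rewrite heterodyne_expectE// /trace_A_rho /KA -sumrB mulr_sumr.
apply: le_trans (ler_cabs_sum _ _ _ _) _; apply: ler_sum => k _.
rewrite -sumrB mulr_sumr.
apply: le_trans (ler_cabs_sum _ _ _ _) _; apply: ler_sum => l _.
rewrite -mulrBr cabsM mulrCA; apply: ler_wpM2l; first exact: cabs_ge0.
set B := eta * _.
have B0 : 0 <= B by rewrite mulr_ge0 ?sqrtr_ge0// ltW.
(* Written as a double sum with Kronecker deltas, the trace term joins the expectation in a single
   sum with coefficients [delta - weight]. *)
have rho_delta : rho l k =
    \sum_(m < E.+1) \sum_(n < E.+1) rho m n * (((m == l) && (n == k))%:R : R)%:C.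
  rewrite (bigD1 l)//= (bigD1 k)//= !eqxx mulr1 big1 => [|n nk]; last first.
    by rewrite (negbTE nk) mulr0.
  rewrite addr0 big1 ?addr0// => m ml; rewrite big1// => n _.
  by rewrite (negbTE ml) mulr0.
rewrite rho_delta -sumrB; apply: le_trans (ler_cabs_sum _ _ _ _) _.
(* Every coefficient is at most [B] in modulus and vanishes off [m + k = n + l], where the entries
   of [rho] have total modulus at most 1. *)
apply: (@le_trans _ _ (B * \sum_(m < E.+1) \sum_(n < E.+1 | (m + k == n + l)%N)
    cabs (rho m n))); last first.
  by rewrite ler_piMr// density_antidiag_le.
rewrite mulr_sumr; apply: ler_sum => m _.
rewrite -sumrB mulr_sumr [leRHS]big_mkcond/=.
apply: le_trans (ler_cabs_sum _ _ _ _) _; apply: ler_sum => n _.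
rewrite -mulrBr -(rmorphB (real_complex R)) cabsM cabs_real mulrC.
have [e|ne] := eqVneq (m + k)%N (n + l)%N; last first.
  have -> : (m == l) && (n == k) = false.
    by apply/negP => /andP[/eqP eml /eqP enk]; rewrite eml enk addnC eqxx in ne.
  by rewrite /weight (negbTE ne) subrr normr0 mul0r.
rewrite ler_wpM2r ?cabs_ge0//.
(* At [m = l] also [n = k], and the weight 1 cancels the delta exactly; elsewhere only the weight
   remains. *)
have [eml|ml] /= := eqVneq m l.
  have enk : n = k by apply: val_inj => /=; rewrite eml in e; lia.
  by rewrite eml enk eqxx weight_diag// subrr normr0.
rewrite sub0r normrN ger0_norm ?weight_ge0//.
by apply: (@weight_le R eta E) => //; rewrite -ltnS.
Qed.
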